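(* For every positive integer $n$ with $n \notin \{3, 5, 7\}$, the rational number $$ \frac{n!^2}{4^n} \sum_{k = 1}^{n} \left(2 + k H_{k - 1}\right) \frac{2^k}{k^2} $$ is a positive integer.
   Context: The harmonic numbers are $H_0 = 0$ and $H_m = \frac{1}{1} + \frac{1}{2} + \cdots + \frac{1}{m}$ for every positive integer $m$. The notation $n!^2$ means $(n!)^2$. *)

(* Defs.v *)
From mathcomp Require Import all_boot all_order all_algebra.

Set Implicit Arguments.
Unset Strict Implicit.
Unset Printing Implicit Defensive.

Import Order.TTheory GRing.Theory Num.Theory.
Local Open Scope ring_scope.

Definition harmonic_number (m : nat) : rat := \sum_(1 <= i < m.+1) i%:R^-1.

(* Main.v *)
(* With a_k = (2 + k H_(k-1)) / k^2, the power series sum a_k x^k is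
   2 Li_2(x) + log(1-x)^2 / 2, which changes sign under x -> x/(x-1).  This map
   fixes x = 2, so the series vanishes 2-adically there.  Truncating that
   argument at order n gives S_n = 2^n * (an integer combination of a_1..a_n),
   hence v_2(S_n) >= n - 2 log_2 n, and Legendre's formula makes n!^2 S_n / 4^n
   2-integral as soon as n > 7 and n is not 9 or 11.  At odd primes integrality
   is clear, since n!^2 a_k is an integer. *)
Require Import Defs.
From mathcomp Require Import all_boot all_order all_algebra.
From mathcomp Require Import ring lra zify.

Set Implicit Arguments.
Unset Strict Implicit.
Unset Printing Implicit Defensive.

Import Order.TTheory GRing.Theory Num.Theory.
Local Open Scope ring_scope.

Lemma harmonic_numberS (m : nat) :
  harmonic_number m.+1 = harmonic_number m + m.+1%:R^-1.
Proof. by rewrite /harmonic_number big_nat_recr. Qed.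

Lemma pnatrS_neq0 (m : nat) : m.+1%:R != 0 :> rat.
Proof. by rewrite pnatr_eq0. Qed.

Lemma sum_alt_binS (m : nat) :
  \sum_(j < m.+1) (-1) ^+ j * 'C(m.+1, j.+1)%:R = 1 :> rat.
Proof.
have := exprDn (1 : rat) (-1) m.+1.
rewrite subrr expr0n /= big_ord_recl /= expr0 bin0 => /eqP.
rewrite expr1n mulr1 mulr1n eq_sym addrC addr_eq0 => /eqP e.
apply: oppr_inj; rewrite -[RHS]e -sumrN; apply: eq_bigr => j _.
by rewrite expr1n mul1r -[bump 0 j]/(j.+1) exprS mulN1r mulNrn mulr_natr.
Qed.

Lemma bin_divS (m j : nat) :
  'C(m, j)%:R / j.+1%:R = 'C(m.+1, j.+1)%:R / m.+1%:R :> rat.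
Proof.
have e : m.+1%:R * 'C(m, j)%:R = j.+1%:R * 'C(m.+1, j.+1)%:R :> rat.
  by rewrite -!natrM (mul_bin_diag m.+1 j).
have := pnatrS_neq0 m; have := pnatrS_neq0 j => hj hm.
by apply/eqP; rewrite eqr_div // mulrC e mulrC.
Qed.

Lemma sum_alt_bin_inv (m : nat) :
  \sum_(j < m.+1) (-1) ^+ j * ('C(m, j)%:R / j.+1%:R) = m.+1%:R^-1 :> rat.
Proof.
under eq_bigr do rewrite bin_divS mulrA.
by rewrite -mulr_suml sum_alt_binS mul1r.
Qed.

(** By Pascal's rule, the increment from [m] to [m.+1] is [sum_alt_bin_inv]. *)
Lemma sum_alt_bin_inv_harmonic (m : nat) :
  \sum_(j < m) (-1) ^+ j * ('C(m, j.+1)%:R / j.+1%:R) = harmonic_number m.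
Proof.
elim: m => [|m IHm]; first by rewrite big_ord0 /harmonic_number big_geq.
rewrite harmonic_numberS -IHm -sum_alt_bin_inv.
under eq_bigr do rewrite binS natrD mulrDl mulrDr.
rewrite big_split /=; congr (_ + _).
by rewrite big_ord_recr /= bin_small // mul0r mulr0 addr0.
Qed.

(** Binomial inverse of the previous identity: Pascal's rule and an index shift leave the
    differences [H_(j+1) - H_j = 1/(j+1)]. *)
Lemma sum_alt_bin_harmonic (m : nat) :
  \sum_(j < m.+1) (-1) ^+ j * ('C(m.+1, j.+1)%:R * harmonic_number j.+1)
    = m.+1%:R^-1.
Proof.
under eq_bigr do rewrite binS natrD mulrDl mulrDr.
rewrite big_split /=.
have -> : \sum_(j < m.+1) (-1) ^+ j * ('C(m, j.+1)%:R * harmonic_number j.+1)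
  = - \sum_(j < m.+1) (-1) ^+ j * ('C(m, j)%:R * harmonic_number j).
  rewrite big_ord_recr big_ord_recl /= bin_small // mul0r mulr0 addr0.
  rewrite {2}/harmonic_number big_geq // !mulr0 add0r -sumrN.
  by apply: eq_bigr => j _; rewrite -[bump 0 j]/(j.+1) exprS !mulN1r mulNr opprK.
rewrite -sum_alt_bin_inv addrC -sumrB; apply: eq_bigr => j _.
by rewrite harmonic_numberS; ring.
Qed.

Definition dilog_coef (k : nat) : rat :=
  (2%:R + k%:R * harmonic_number k.-1) / k%:R ^+ 2.

(** Moving one [1/k] into the harmonic number makes the two summands dual: the alternating binomial
    transform swaps [1/(j+1)] and [H_(j+1)]. *)
Lemma dilog_coefS (j : nat) :
  dilog_coef j.+1 = (j.+1%:R^-1 + harmonic_number j.+1) / j.+1%:R.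
Proof.
rewrite /dilog_coef harmonic_numberS /=.
by field; rewrite nat1r pnatrS_neq0.
Qed.

(* The antisymmetry under x -> x/(x-1), coefficientwise. *)
Lemma dilog_coef_binomial (i : nat) :
  dilog_coef i.+1 = \sum_(j < i.+1) (-1) ^+ j * 'C(i, j)%:R * dilog_coef j.+1.
Proof.
rewrite dilog_coefS -{1}sum_alt_bin_harmonic -sum_alt_bin_inv_harmonic.
rewrite -big_split mulr_suml; apply: eq_bigr => j _ /=.
have -> : 'C(i, j)%:R = 'C(i.+1, j.+1)%:R / i.+1%:R * j.+1%:R :> rat.
  by rewrite -bin_divS divfK ?pnatrS_neq0.
by rewrite dilog_coefS; field; rewrite !nat1r !pnatrS_neq0.
Qed.

(** Horner form of the sum of [(-2)^(j-t) C(n,t)] over [t <= j]. That it is an integer is what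
    yields the power of 2. *)
Fixpoint geom_rem (n j : nat) : int :=
  if j is j'.+1 then 'C(n, j)%:Z - 2 * geom_rem n j' else 1.

(* A truncation of sum_i x^(i+1) C(i,j) = (x/(1-x))^(j+1) at x = 2. *)
Lemma sum_pow2_bin (n j : nat) :
  \sum_(i < n) 2 ^+ i.+1 * 'C(i, j)%:R
    = 2 ^+ n.+1 * (geom_rem n j)%:~R - (-1) ^+ j * 2 ^+ j.+1 :> rat.
Proof.
elim: j => [|j IHj].
  rewrite /= mulr1 mul1r.
  elim: n => [|n IHn]; first by rewrite big_ord0 subrr.
  by rewrite big_ord_recr /= IHn bin0 !exprS; ring.
(* Summation by parts: telescope [2^(i+1) C(i,j+1)]. *)
have -> : \sum_(i < n) 2 ^+ i.+1 * 'C(i, j.+1)%:R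
    = 2 ^+ n.+1 * 'C(n, j.+1)%:R
      - 2 * \sum_(i < n) 2 ^+ i.+1 * 'C(i, j)%:R :> rat.
  elim: n {IHj} => [|n IHn]; first by rewrite !big_ord0 bin_small // !mulr0 subrr.
  by rewrite !big_ord_recr /= IHn binS natrD !exprS; ring.
by rewrite IHj /= rmorphB rmorphM /= !exprS; ring.
Qed.

Lemma sum_dilog_coef_pow2 (n : nat) :
  \sum_(i < n) 2 ^+ i.+1 * dilog_coef i.+1
    = 2 ^+ n * \sum_(j < n) (-1) ^+ j * (geom_rem n j)%:~R * dilog_coef j.+1.
Proof.
set S := LHS; set A := \sum_(j < n) _.
(* The terms [-(-1)^j 2^(j+1)] of [sum_pow2_bin] rebuild [-S], as 2 is the fixed point; the
   remainders form [A]. *)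
suff e : S = 2 ^+ n.+1 * A - S.
  by apply: (@mulfI _ 2) => //; rewrite mulrA -exprS; lra.
rewrite {1}/S.
have -> : \sum_(i < n) 2 ^+ i.+1 * dilog_coef i.+1
  = \sum_(i < n) \sum_(j < n)
      2 ^+ i.+1 * 'C(i, j)%:R * ((-1) ^+ j * dilog_coef j.+1).
  apply: eq_bigr => i _; rewrite dilog_coef_binomial mulr_sumr.
  rewrite (big_ord_widen _ (fun j => 2 ^+ i.+1 *
    ((-1) ^+ j * 'C(i, j)%:R * dilog_coef j.+1)) (ltn_ord i)).
  rewrite [LHS]big_mkcond; apply: eq_bigr => j _.
  case: ltnP => h; first by ring.
  by rewrite bin_small // mulr0 mul0r.
rewrite exchange_big /= /A /S mulr_sumr -sumrB; apply: eq_bigr => j _.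
rewrite -mulr_suml sum_pow2_bin mulrBl; congr (_ - _); first by ring.
by rewrite mulrACA -expr2 sqrr_sign mul1r.
Qed.

Lemma dvdn_rat_int (d m : nat) : (d %| m)%N -> m%:R / d%:R \is a @Num.int rat.
Proof.
move=> /dvdnP[q ->]; have [->|d0] := eqVneq d 0; first by rewrite invr0 mulr0.
by rewrite natrM mulfK ?pnatr_eq0 // natr_int.
Qed.

Lemma harmonic_number_int (d m : nat) :
  (forall i, (0 < i <= m)%N -> (i %| d)%N) ->
  d%:R * harmonic_number m \is a Num.int.
Proof.
move=> hd; rewrite mulr_sumr big_seq rpred_sum // => i.
by rewrite mem_index_iota ltnS => hi; apply/dvdn_rat_int/hd.
Qed.

Lemma dilog_coef_int (d j : nat) :
  (forall i, (0 < i <= j.+1)%N -> (i %| d)%N) ->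
  d%:R ^+ 2 * dilog_coef j.+1 \is a Num.int.
Proof.
move=> hd; have hj : d%:R / j.+1%:R \is a @Num.int rat.
  by apply/dvdn_rat_int/hd; rewrite leqnn.
have -> : d%:R ^+ 2 * dilog_coef j.+1 =
    d%:R / j.+1%:R * (d%:R / j.+1%:R + d%:R * harmonic_number j.+1).
  by rewrite dilog_coefS; ring.
by rewrite rpredM ?rpredD ?harmonic_number_int.
Qed.

Lemma coprime_mul_int (x : rat) (a b : nat) : coprime a b ->
  a%:R * x \is a Num.int -> b%:R * x \is a Num.int -> x \is a Num.int.
Proof.
move=> cab xa xb; have [u [v e]] := Bezoutz a b.
have -> : x = u%:~R * (a%:R * x) + v%:~R * (b%:R * x).
  rewrite !mulrA -mulrDl -[a%:R]/(a%:~R) -[b%:R]/(b%:~R) -!rmorphM -rmorphD /= e.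
  by rewrite /gcdz /= (eqP cab) mul1r.
by rewrite rpredD // rpredM // intr_int.
Qed.

(** A common multiple of [1..n] that is cheap at 2: only [2^L] instead of the full 2-part of
    [n!]. *)
Lemma dvdn_pow2_odd_part_fact (L n i : nat) :
  (n < 2 ^ L.+1)%N -> (0 < i <= n)%N -> (i %| 2 ^ L * n`!`_2^')%N.
Proof.
move=> hL /andP[i0 hi]; rewrite -(partnC 2%N i0) dvdn_mul //.
  rewrite p_part dvdn_exp2l // -ltnS -(ltn_exp2l _ _ (ltnSn 1)).
  apply: leq_ltn_trans hL; apply: leq_trans hi.
  exact: dvdn_leq (pfactor_dvdnn _ _).
by apply: partn_dvd; rewrite ?fact_gt0 // dvdn_fact // i0.
Qed.

Lemma sum_dilog_int (L n : nat) :
    (n < 2 ^ L.+1)%N -> (2 ^ (n + L.*2) %| n`! ^ 2)%N ->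
  (n`!)%:R ^+ 2 / 4 ^+ n * \sum_(i < n) 2 ^+ i.+1 * dilog_coef i.+1
    \is a Num.int.
Proof.
move=> hL h2; set x := (X in X \is a _); set m := (n`!`_2^')%N.
have two0 k : 2 ^+ k != 0 :> rat by rewrite expf_neq0.
have four k : 4 ^+ k = 2 ^+ k * 2 ^+ k :> rat by rewrite -exprMn -natrM.
(* Multiplying by [4^n] tests the odd primes; multiplying by the odd [m^2] tests the prime 2. *)
apply: (@coprime_mul_int _ (4 ^ n) (m ^ 2)).
- rewrite coprimeXl // coprimeXr // -[4%N]/(2 ^ 2)%N coprimeXl //.
  by rewrite -[2%N](part_pnat_id (pnat_id _)) // coprime_partC.
- rewrite /x natrX mulrA [4%:R ^+ n * _]mulrC divfK ?four ?mulf_neq0 //.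
  rewrite mulr_sumr rpred_sum // => i _; rewrite mulrCA rpredM ?rpredX //.
  apply: dilog_coef_int => k /andP[k0 hk]; apply: dvdn_fact.
  by rewrite k0 (leq_trans hk).
set A := \sum_(j < n) (-1) ^+ j * (geom_rem n j)%:~R * dilog_coef j.+1.
have -> : (m ^ 2)%:R * x = (n`! ^ 2)%:R / (2 ^ (n + L.*2))%:R
    * ((2 ^ L * m)%:R ^+ 2 * A).
  rewrite /x sum_dilog_coef_pow2 -/A four !natrX natrM natrX -addnn !exprD.
  by field; rewrite !two0.
rewrite rpredM ?dvdn_rat_int // mulr_sumr rpred_sum // => j _.
rewrite mulrCA rpredM //; last first.
  apply: dilog_coef_int => i /andP[i0 hi]; apply: dvdn_pow2_odd_part_fact => //.
  by rewrite i0 (leq_trans hi).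
by rewrite rpredM ?rpredX ?intr_int // rpredN.
Qed.

Lemma logn2_fact_ge (n : nat) :
  (7 < n -> n %/ 2 + n %/ 4 + n %/ 8 <= logn 2 n`!)%N.
Proof.
move=> hn; rewrite logn_fact // (big_ltn (m := 1)) ?(big_ltn (m := 2)) ?(big_ltn (m := 3)); [|lia..].
by rewrite !addnA leq_addr.
Qed.

(** At 9 and 11 the required exponent [n + 2L], with [L = 3], exceeds [2 v_2(n!)] by exactly one. *)
Lemma pow2_dvdn_sqr_fact (n : nat) : (7 < n)%N -> n \notin [:: 9; 11]%N ->
  exists2 L, (n < 2 ^ L.+1)%N & (2 ^ (n + L.*2) %| n`! ^ 2)%N.
Proof.
rewrite !inE => n7 n911; exists (trunc_log 2 n); first exact: trunc_log_ltn.
rewrite pfactor_dvdn ?expn_gt0 ?fact_gt0 // lognX.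
have := logn2_fact_ge n7.
have := @trunc_logP 2 n isT (ltn_trans (isT : 0 < 7)%N n7).
move: (trunc_log 2 n) => L hL hf.
apply: (leq_trans _ (leq_mul (leqnn 2) hf)).
case: (leqP 5 L) => L5; last by move: L L5 hL => [|[|[|[|[|L]]]]] // _; lia.
(* Bounding the floors gives [2 v_2(n!) >= (7n - 17)/4], so [3n >= 8L + 17] suffices; this follows
   from [n >= 2^L >= 4L + 5]. *)
suff : (4 * L + 5 <= 2 ^ L)%N by lia.
elim: L L5 {hL} => // L IH; rewrite leq_eqVlt => /predU1P[<-//|/IH].
by rewrite expnS; lia.
Qed.

Theorem theorem2p3 (n : nat) (hn : (0 < n)%N) (hn357 : n \notin [:: 3; 5; 7]%N) :
  let x : rat :=
    (n`!)%:R ^+ 2 / 4%:R ^+ n *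
    \sum_(1 <= k < n.+1)
      (2%:R + k%:R * harmonic_number k.-1) * (2%:R ^+ k / k%:R ^+ 2) in
  (x \is a Num.int) /\ (0 < x).
Proof.
move=> x; split; last first.
  rewrite mulr_gt0 ?divr_gt0 ?exprn_gt0 ?ltr0n ?fact_gt0 //.
  have term_ge0 k : 0 <= (2%:R + k%:R * harmonic_number k.-1) *
      (2%:R ^+ k / k%:R ^+ 2) :> rat.
    rewrite mulr_ge0 ?divr_ge0 ?exprn_ge0 ?ler0n // addr_ge0 // mulr_ge0 ?ler0n //.
    by rewrite sumr_ge0 // => i _; rewrite invr_ge0 ler0n.
  (* Strictness comes from the term [k = 1], which equals 4. *)
  rewrite big_ltn // ltr_wpDr ?sumr_ge0 //.
  by rewrite /harmonic_number big_geq // mulr0 addr0.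
have [/andP[n7 n911]|small] := boolP ((7 < n)%N && (n \notin [:: 9; 11]%N)).
  have [L hL h2] := pow2_dvdn_sqr_fact n7 n911.
  have := sum_dilog_int hL h2; congr (_ * _ \is a _).
  rewrite big_add1 big_mkord; apply: eq_bigr => i _.
  by rewrite /dilog_coef mulrCA mulrA.
(* The cases outside the valuation bound are evaluated explicitly. *)
have : n \in [:: 1; 2; 4; 6; 9; 11]%N.
  move: n hn hn357 small {x} => [|[|[|[|[|[|[|[|n]]]]]]]] //= _ _.
  by rewrite negbK !inE => /orP[]/eqP->.
have harm0 : harmonic_number 0 = 0 by rewrite /harmonic_number big_geq.
(* Values above 1000 are given in base 1000, as numerals are unary. *)
have int_base (a b c d t : nat) :
    a%:R * t%:R ^+ 3 + b%:R * t%:R ^+ 2 + c%:R * t%:R + d%:R \is a @Num.int rat.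
  by rewrite -!natrX -!natrM -!natrD natr_int.
rewrite {}/x !inE => /or4P[|||/or3P[]] /eqP->;
  rewrite unlock /= ?harmonic_numberS harm0 !factS fact0 ?natrM.
- by rewrite [X in X \is a _](_ : _ = 1); [exact: rpred1|field].
- by rewrite [X in X \is a _](_ : _ = 2); [exact: natr_int|field].
- by rewrite [X in X \is a _](_ : _ = 52); [exact: natr_int|field].
- rewrite [X in X \is a _](_ : _ =
    0 * 1000 ^+ 3 + 0 * 1000 ^+ 2 + 8 * 1000 + 469); last by field.
  exact: (int_base 0 0 8 469 1000)%N.
- rewrite [X in X \is a _](_ : _ =
    0 * 1000 ^+ 3 + 188 * 1000 ^+ 2 + 457 * 1000 + 516); last by field.
  exact: (int_base 0 188 457 516 1000)%N.
- rewrite [X in X \is a _](_ : _ =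
    480 * 1000 ^+ 3 + 366 * 1000 ^+ 2 + 769 * 1000 + 950); last by field.
  exact: (int_base 480 366 769 950 1000)%N.
Qed.
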